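(* Let $\mathsf M\subset\mathbb{R}^D$ be a compact $C^2$ submanifold. There exist positive constants $C_1,C_2,C_3,C_4,C_5$ and $\varepsilon_0$ such that the following holds. Let $\mathsf A\subset\mathsf M$ be a compact set with $d_H(\mathsf A,\mathsf M)\leq\varepsilon\leq\varepsilon_0$. 1. For every critical point $z\in Z(\mathsf A)$, exactly one of these two possibilities is true: either $z$ is very close to $\mathsf M$, that is $d_{\mathsf M}(z)\leq C_1\varepsilon^2$, or it is close to a $\mu$-critical point of $\mathsf M$, that is $d_{Z_\mu(\mathsf M)}(z)\leq C_2\varepsilon$ for $\mu=C_3\varepsilon$. 2. If $\mathsf M$ satisfies (P4), then, in the second case, the critical point $z\in Z(\mathsf A)$ is close to $Z(\mathsf M)$, that is $d_{Z(\mathsf M)}(z)\leq C_4\varepsilon$. 3. If $\mathsf M$ additionally satisfies (P1), (P2) and (P3), then, in the second case, the set of projections $\pi_{\mathsf A}(z)$ of the critical point $z\in Z(\mathsf A)$ is included in a neighborhood of size $C_5\varepsilon$ of $\pi_{\mathsf M}(z')$ for some $z'\in Z(\mathsf M)$ such that $d(z,z')\leq C_4\varepsilon$.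
   Context: Standing assumptions: $\dim \mathsf M\geq 1$ and $D\geq 2$. $d_H$ is the Hausdorff distance; $d_X(z)$ denotes the distance from $z$ to the set $X$. Distance function. For a nonempty compact set $\mathsf{S}\subset\mathbb{R}^D$, let $d_{\mathsf S}(x)=\min_{y\in \mathsf S}\|x-y\|$ and $\pi_{\mathsf S}(x)=\{y\in\mathsf S: \|x-y\|=d_{\mathsf S}(x)\}$. For a nonempty bounded set $\sigma$, $m(\sigma)$ is the center of its smallest enclosing ball. The generalized gradient is $\nabla d_{\mathsf S}(x)=\frac{x-m(\pi_{\mathsf S}(x))}{d_{\mathsf S}(x)}$ for $x\notin\mathsf S$ and $0$ for $x\in\mathsf S$. The set of critical points is $Z(\mathsf S)=\{z\in\mathbb{R}^D\setminus\mathsf S:\nabla d_{\mathsf S}(z)=0\}$, and for $\mu\in[0,1]$ the set of $\mu$-critical points is $Z_\mu(\mathsf S)=\{z\in\mathbb{R}^D\setminus \mathsf S:\|\nabla d_{\mathsf S}(z)\|\leq\mu\}$. Conditions on a compact submanifold $\mathsf M\subset\mathbb{R}^D$ ($B(x,r)$ is the open ball): (P1) For every $z_0\in Z(\mathsf M)$, the projections $\pi_{\mathsf M}(z_0)$ are the vertices of a non-degenerate simplex (i.e. form a finite affinely independent set; in particular there are at most $D+1$ of them), and $z_0$ belongs to the relative interior of the convex hull of $\pi_{\mathsf M}(z_0)$. (P2) $Z(\mathsf M)$ is finite. (P3) For every $z_0\in Z(\mathsf M)$ and every $x_0\in\pi_{\mathsf M}(z_0)$, there exist $\delta>0$ and $\alpha>0$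 such that for all $y\in\mathsf M\cap B(x_0,\delta)$, $\|y-z_0\|^2\geq\|x_0-z_0\|^2+\alpha\|y-x_0\|^2$. (P4) There exist $C>0$ and $\mu_0\in(0,1)$ such that for every $\mu\in[0,\mu_0)$, every point of $Z_\mu(\mathsf M)$ is at distance at most $C\mu$ from $Z(\mathsf M)$. *)

(* Defs.v *)
From mathcomp Require Import all_boot all_order all_algebra.
From mathcomp Require Import all_classical all_reals all_analysis.

Set Implicit Arguments.
Unset Strict Implicit.
Unset Printing Implicit Defensive.

Import Order.TTheory GRing.Theory Num.Theory.
Import numFieldNormedType.Exports.

Local Open Scope classical_set_scope.
Local Open Scope ring_scope.

Section Euclidean.
Context {R : realType} {D : nat}.
Implicit Types (S A B : set 'rV[R]_D) (x y c : 'rV[R]_D) (r : R).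

(* The library norm `|x| on 'rV[R]_D is the sup norm. It induces the same
   topology, so open, compact, differentiable are used as they stand. *)
Definition enorm x : R := Num.sqrt (\sum_(i < D) x 0 i ^+ 2).

(* Extended-valued, so that the distance to the empty set is +oo and not the
   junk value inf set0 = 0. *)
Definition edist_to S x : \bar R :=
  ereal_inf [set (enorm (x - y))%:E | y in S].

(* For S nonempty; the infimum is a minimum when S is moreover compact. *)
Definition dist_to S x : R := fine (edist_to S x).

Definition hausdorff A B : \bar R :=
  maxe (ereal_sup [set edist_to B x | x in A])
       (ereal_sup [set edist_to A y | y in B]).

Definition projections S x : set 'rV[R]_D :=
  [set y | S y /\ enorm (x - y) = dist_to S x].

Definition encloses c r S := forall y, S y -> enorm (y - c) <= r.

Definition is_seb_center S c :=
  exists r, encloses c r S /\ forall c' r', encloses c' r' S -> r <= r'.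

(* The smallest enclosing ball of a nonempty bounded set exists and is unique;
   the value 0 is only a default. *)
Definition seb_center S : 'rV[R]_D := xget 0 [set c | is_seb_center S c].

Definition grad_dist S x : 'rV[R]_D :=
  if `[< S x >] then 0
  else (dist_to S x)^-1 *: (x - seb_center (projections S x)).

Definition crit S : set 'rV[R]_D := [set z | ~ S z /\ grad_dist S z = 0].

Definition mu_crit (mu : R) S : set 'rV[R]_D :=
  [set z | ~ S z /\ enorm (grad_dist S z) <= mu].

Definition affine_hull S : set 'rV[R]_D :=
  [set x | exists n (p : 'I_n -> 'rV[R]_D) (w : 'I_n -> R),
     [/\ forall i, S (p i), \sum_i w i = 1 & x = \sum_i w i *: p i]].

Definition convex_hull S : set 'rV[R]_D :=
  [set x | exists n (p : 'I_n -> 'rV[R]_D) (w : 'I_n -> R),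
     [/\ forall i, S (p i), forall i, 0 <= w i, \sum_i w i = 1
       & x = \sum_i w i *: p i]].

Definition relative_interior S : set 'rV[R]_D :=
  [set x | S x /\ exists2 r, 0 < r &
     forall y, affine_hull S y -> enorm (y - x) < r -> S y].

Definition affinely_independent n (p : 'I_n -> 'rV[R]_D) :=
  forall w : 'I_n -> R,
    \sum_i w i = 0 -> \sum_i w i *: p i = 0 -> forall i, w i = 0.

Definition simplex_vertices S :=
  exists n (p : 'I_n.+1 -> 'rV[R]_D),
    affinely_independent p /\ S = range p.

End Euclidean.

Section Submanifold.
Context {R : realType} {D : nat}.
Implicit Types (U M : set 'rV[R]_D) (f phi psi : 'rV[R]_D -> 'rV[R]_D).

(* To be used with U open. Continuity of x |-> 'D_v f x for every fixed v is,
   in finite dimension, continuity of the differential. *)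
Definition C1_on U f :=
  (forall x, U x -> differentiable f x) /\
  (forall v x, U x -> {for x, continuous (fun y => 'D_v f y)}).

Definition C2_on U f :=
  C1_on U f /\ forall v, C1_on U (fun y => 'D_v f y).

(* phi is a C^2 diffeomorphism from the open set U onto the open set phi @` U,
   with inverse psi. *)
Definition C2_diffeo U phi psi :=
  [/\ open U, open (phi @` U), C2_on U phi, C2_on (phi @` U) psi
    & forall y, U y -> psi (phi y) = y].

(* Embedded d-dimensional submanifold without boundary: near each of its points
   M is straightened to R^d x {0} by a C^2 change of coordinates of R^D. *)
Definition C2_submanifold (d : nat) M :=
  (d <= D)%N /\
  forall x, M x -> exists U phi psi,
    [/\ U x, C2_diffeo U phi psi
      & forall y, U y -> (M y <-> forall i : 'I_D, (d <= i)%N -> phi y 0 i = 0)].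

End Submanifold.

Section Conditions.
Context {R : realType} {D : nat}.
Implicit Type M : set 'rV[R]_D.

Definition condP1 M := forall z0, crit M z0 ->
  simplex_vertices (projections M z0) /\
  relative_interior (convex_hull (projections M z0)) z0.

Definition condP2 M := finite_set (crit M).

Definition condP3 M := forall z0 x0, crit M z0 -> projections M z0 x0 ->
  exists delta alpha : R, [/\ 0 < delta, 0 < alpha &
    forall y, M y -> enorm (y - x0) < delta ->
      enorm (y - z0) ^+ 2 >= enorm (x0 - z0) ^+ 2 + alpha * enorm (y - x0) ^+ 2].

Definition condP4 M := exists C mu0 : R, [/\ 0 < C, 0 < mu0 < 1 &
  forall mu, 0 <= mu < mu0 -> forall z, mu_crit mu M z ->
    (edist_to (crit M) z <= (C * mu)%:E)%E].

End Conditions.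

(* Main.v *)
(* Let d = d_M(z) and r = d_A(z) for a critical point z of A. Positive reach of
   M, in the form |<a - y, z - y>| <= K |a - y|^2 d for y a projection of z on M
   and a in M, gives r^2 <= d^2 + c eps^2, by taking for a a point of A that is
   eps-close to y. Criticality says that in every direction u some projection p
   of z on A has <u, p - z> >= 0. With u = z - y and d small, the reach
   inequality for p forces d <= 2 K c eps^2. When d is bounded below,
   criticality also gives d_M^2 <= d^2 + c eps^2 + |. - z|^2 everywhere, so a
   maximiser of d_M^2 - 2 |. - z|^2 is O(eps)-close to z, and it is
   O(eps)-critical because d_M^2 grows along its gradient. This replaces the
   gradient flow argument for stability of critical points. Finally, under (P3),
   |y - z'|^2 - d_M(z')^2 controls the squared distance from y in M to the
   projections of z', and comparing y in pi_A(z) with one such projection bounds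
   that square by O(eps) times the distance itself. *)

Require Import Defs.
From mathcomp Require Import all_boot all_order all_algebra.
From mathcomp Require Import all_classical all_reals all_analysis.
From mathcomp Require Import ring lra.

Set Implicit Arguments.
Unset Strict Implicit.
Unset Printing Implicit Defensive.

Import Order.TTheory GRing.Theory Num.Theory.
Import numFieldNormedType.Exports.

Local Open Scope classical_set_scope.
Local Open Scope ring_scope.

(** * The Euclidean inner product, and [enorm] against the sup norm *)

Section InnerProduct.
Context {R : realType} {D : nat}.
Implicit Types (x y z u v c : 'rV[R]_D) (t : R).

Definition dot x y : R := \sum_(i < D) x 0 i * y 0 i.

Lemma dotC x y : dot x y = dot y x.
Proof. by apply: eq_bigr => i _; rewrite mulrC. Qed.

Lemma dotDl x y z : dot (x + y) z = dot x z + dot y z.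
Proof. by rewrite -big_split/=; apply: eq_bigr => i _; rewrite mxE mulrDl. Qed.

Lemma dotZl t x y : dot (t *: x) y = t * dot x y.
Proof. by rewrite mulr_sumr; apply: eq_bigr => i _; rewrite mxE mulrA. Qed.

Lemma dotDr x y z : dot z (x + y) = dot z x + dot z y.
Proof. by rewrite dotC dotDl !(dotC z). Qed.

Lemma dotZr t x y : dot x (t *: y) = t * dot x y.
Proof. by rewrite dotC dotZl dotC. Qed.

Lemma dotNl x y : dot (- x) y = - dot x y.
Proof. by rewrite -scaleN1r dotZl mulN1r. Qed.

Lemma dotNr x y : dot x (- y) = - dot x y.
Proof. by rewrite dotC dotNl dotC. Qed.

Lemma dotBl x y z : dot (x - y) z = dot x z - dot y z.
Proof. by rewrite dotDl dotNl. Qed.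

Lemma dotBr x y z : dot z (x - y) = dot z x - dot z y.
Proof. by rewrite dotDr dotNr. Qed.

Definition dotE := (dotBl, dotBr, dotDl, dotDr, dotZl, dotZr, dotNl, dotNr).

Lemma dot_ge0 x : 0 <= dot x x.
Proof. by apply: sumr_ge0 => i _; rewrite -expr2 sqr_ge0. Qed.

Lemma enorm_sqr x : enorm x ^+ 2 = dot x x.
Proof.
rewrite sqr_sqrtr; last by apply: sumr_ge0 => i _; rewrite sqr_ge0.
by apply: eq_bigr => i _; rewrite expr2.
Qed.

Lemma enorm_ge0 x : 0 <= enorm x.
Proof. exact: sqrtr_ge0. Qed.

Lemma ler_enorm x t : 0 <= t -> (enorm x <= t) = (dot x x <= t ^+ 2).
Proof. by move=> t0; rewrite -enorm_sqr ler_sqr // nnegrE enorm_ge0. Qed.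

Lemma enorm0 : enorm (0 : 'rV[R]_D) = 0.
Proof. by rewrite /enorm big1 ?sqrtr0 // => i _; rewrite mxE expr0n. Qed.

Lemma enorm0_eq0 x : enorm x = 0 -> x = 0.
Proof.
move=> x0; have /eqP : dot x x = 0 by rewrite -enorm_sqr x0 expr0n.
rewrite psumr_eq0 => [/allP xi0|i _]; last by rewrite -expr2 sqr_ge0.
apply/rowP => i; rewrite mxE; have := xi0 i; rewrite mem_index_enum /=.
by move=> /(_ isT); rewrite mulf_eq0 orbb => /eqP.
Qed.

Lemma enorm_gt0 x : x <> 0 -> 0 < enorm x.
Proof.
by move=> x0; rewrite lt_def enorm_ge0 andbT; apply/eqP => /enorm0_eq0.
Qed.

Lemma enormN x : enorm (- x) = enorm x.
Proof. by congr Num.sqrt; apply: eq_bigr => i _; rewrite mxE sqrrN. Qed.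

Lemma enormB x y : enorm (x - y) = enorm (y - x).
Proof. by rewrite -enormN opprB. Qed.

Lemma enormZ t x : enorm (t *: x) = `|t| * enorm x.
Proof.
rewrite /enorm -sqrtr_sqr -sqrtrM ?sqr_ge0 // mulr_sumr.
by congr Num.sqrt; apply: eq_bigr => i _; rewrite mxE exprMn.
Qed.

(** Expand the squared norm of [dot y y *: x - dot x y *: y] and cancel one factor [dot y y];
    [y = 0] is treated apart. *)
Lemma cauchy_schwarz x y : `|dot x y| <= enorm x * enorm y.
Proof.
rewrite -ler_sqr ?nnegrE ?mulr_ge0 ?enorm_ge0 // exprMn !enorm_sqr.
rewrite real_normK ?num_real //.
have [y0|/eqP y0] := eqVneq (enorm y) 0.
  by rewrite (enorm0_eq0 y0) -(scale0r 0) !dotZr !mul0r mulr0 expr0n.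
have yy : 0 < dot y y.
  by rewrite -enorm_sqr exprn_gt0 // lt_def enorm_ge0 andbT; apply/eqP.
have := dot_ge0 (dot y y *: x - dot x y *: y).
rewrite !dotE (dotC y x) => H.
by rewrite -subr_ge0 -(pmulr_rge0 _ yy); nra.
Qed.

Lemma dot_le x y : dot x y <= enorm x * enorm y.
Proof. exact: le_trans (ler_norm _) (cauchy_schwarz x y). Qed.

Lemma enormD x y : enorm (x + y) <= enorm x + enorm y.
Proof.
rewrite ler_enorm ?addr_ge0 ?enorm_ge0 // sqrrD !enorm_sqr !dotE (dotC y x).
have := dot_le x y; lra.
Qed.

Lemma enormD_sqr_le x y :
  enorm (x + y) ^+ 2 <= 2 * enorm x ^+ 2 + 2 * enorm y ^+ 2.
Proof.
have := dot_ge0 (x - y); rewrite !enorm_sqr !dotE (dotC y x); lra.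
Qed.

Lemma enorm_triangle x y z : enorm (x - z) <= enorm (x - y) + enorm (y - z).
Proof. by have := enormD (x - y) (y - z); rewrite addrA subrK. Qed.

Lemma sqdistD x y u :
  enorm (x + u - y) ^+ 2 =
  enorm (x - y) ^+ 2 + 2 * dot (x - y) u + enorm u ^+ 2.
Proof. rewrite addrAC !enorm_sqr !dotE (dotC u x) (dotC u y); ring. Qed.

Lemma enorm_coord x i : `|x 0 i| <= enorm x.
Proof.
rewrite -sqrtr_sqr ler_sqrt ?sumr_ge0 // => [|j _]; last exact: sqr_ge0.
by rewrite (bigD1 i) //= lerDl sumr_ge0 // => j _; rewrite sqr_ge0.
Qed.

Lemma norm_le_enorm x : `|x| <= enorm x.
Proof.
rewrite [leLHS]/Num.Def.normr/= mx_normrE; apply: bigmax_le => [|[i j] _] /=.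
  exact: enorm_ge0.
by rewrite (ord1 i) enorm_coord.
Qed.

Lemma coord_le_norm x i : `|x 0 i| <= `|x|.
Proof.
rewrite [leRHS]/Num.Def.normr/= mx_normrE.
exact: (le_bigmax _ (fun ij : 'I_1 * 'I_D => `|x ij.1 ij.2|) (0, i)).
Qed.

(** The sharp constant is the square root of [D]; the cruder [D] avoids a root. *)
Lemma enorm_le_coord x t : 0 <= t -> (forall i, `|x 0 i| <= t) ->
  enorm x <= D%:R * t.
Proof.
move=> t0 xt.
rewrite -ler_sqr ?nnegrE ?enorm_ge0 ?mulr_ge0 // sqr_sqrtr; last first.
  by apply: sumr_ge0 => i _; rewrite sqr_ge0.
apply: (@le_trans _ _ (\sum_(i < D) t ^+ 2)).
  apply: ler_sum => i _; rewrite -[x 0 i ^+ 2]real_normK ?num_real //.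
  by rewrite ler_sqr ?nnegrE.
rewrite sumr_const card_ord -[leLHS]mulr_natl exprMn ler_wpM2r ?sqr_ge0 //.
by rewrite -natrX ler_nat; case: D => // n; rewrite leq_pmulr.
Qed.

Lemma enorm_le_norm x : enorm x <= D%:R * `|x|.
Proof. by apply: enorm_le_coord => // i; exact: coord_le_norm. Qed.

End InnerProduct.

(** * Continuity, compactness and extrema in terms of [enorm] *)

Section Topology.
Context {R : realType} {D : nat}.
Implicit Types (x y z u v c : 'rV[R]_D) (S : set 'rV[R]_D).

(** Swapping [x] and [y] makes the one-sided hypothesis two-sided; the factor [D] passes from
    [enorm] to the sup norm. *)
Lemma enorm_lipschitz_continuous (f : 'rV[R]_D -> R) (L : R) :
  (forall x y, f x - f y <= L * enorm (x - y)) -> continuous f.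
Proof.
move=> fL x; apply/(@cvgrPdist_le _ _ _ (nbhs x)) => e e0.
set k := `|L| * D%:R + 1; have k0 : 0 < k by rewrite ltr_wpDl ?mulr_ge0.
near=> y.
have le z w : f z - f w <= k * `|z - w|.
  apply: le_trans (fL z w) _.
  apply: (@le_trans _ _ (`|L| * (D%:R * `|z - w|))).
    apply: (@le_trans _ _ (`|L| * enorm (z - w))).
      by rewrite ler_wpM2r ?enorm_ge0 ?ler_norm.
    by rewrite ler_wpM2l ?enorm_le_norm.
  by rewrite mulrA ler_wpM2r // /k lerDl.
apply: (@le_trans _ _ (k * `|x - y|)).
  by rewrite ler_norml le andbT lerNl opprB distrC le.
rewrite mulrC -ler_pdivlMr //; near: y.
by apply: (@cvgrPdist_le _ _ _ (nbhs x) _ id x).1 cvg_id _ _; rewrite divr_gt0.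
Unshelve. all: by end_near. Qed.

Lemma continuous_dist c : continuous (fun x => enorm (x - c)).
Proof.
apply: (@enorm_lipschitz_continuous _ 1) => x y.
by rewrite mul1r lerBlDr enorm_triangle.
Qed.

Lemma continuous_dotl u c : continuous (fun x => dot u (x - c)).
Proof.
apply: (@enorm_lipschitz_continuous _ (enorm u)) => x y.
by rewrite -dotBr opprB addrA subrK dot_le.
Qed.

Lemma compact_min (f : 'rV[R]_D -> R) S : S !=set0 -> compact S ->
  continuous f -> exists2 c, S c & forall x, S x -> f c <= f x.
Proof.
move=> S0 cS cf.
have [|c /set_mem Sc cmin] := compact_EVT_min (f := f) S0 cS.
  exact: continuous_subspaceT.
by exists c => // x Sx; apply: cmin; rewrite inE.
Qed.

Lemma compact_max (f : 'rV[R]_D -> R) S : S !=set0 -> compact S ->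
  continuous f -> exists2 c, S c & forall x, S x -> f x <= f c.
Proof.
move=> S0 cS cf.
have [|c /set_mem Sc cmax] := compact_EVT_max (f := f) S0 cS.
  exact: continuous_subspaceT.
by exists c => // x Sx; apply: cmax; rewrite inE.
Qed.

Lemma closed_sublevel (f : 'rV[R]_D -> R) a :
  continuous f -> closed [set x | f x <= a].
Proof.
move=> cf; rewrite (_ : [set x | _] = f @^-1` [set t | t <= a]) //.
by apply: preimage_closed => //; exact: closed_le.
Qed.

Lemma compact_eball c r : compact [set x | enorm (x - c) <= r].
Proof.
apply: bounded_closed_compact; last exact/closed_sublevel/continuous_dist.
exists (r + enorm c); split; first exact: num_real.
move=> t rt x /= xr; apply: le_trans (ltW rt).
apply: le_trans (norm_le_enorm x) _.
by rewrite -{1}(subrK c x) (le_trans (enormD _ _)) // lerD2r.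
Qed.

(** Minimise over the compact ball, which contains [c]; outside it [f c] is already a lower
    bound. *)
Lemma ex_min_of_far (f : 'rV[R]_D -> R) c r : 0 <= r -> continuous f ->
    (forall x, r < enorm (x - c) -> f c <= f x) ->
  exists x0, forall x, f x0 <= f x.
Proof.
move=> r0 cf far.
have [| | |x0 _ x0min] := @compact_min f [set x | enorm (x - c) <= r].
- by exists c; rewrite /= subrr enorm0.
- exact: compact_eball.
- exact: cf.
exists x0 => x; have [|/far] := leP (enorm (x - c)) r; first exact: x0min.
by apply: le_trans; apply: x0min; rewrite /= subrr enorm0.
Qed.

Lemma compact_ebounded S : compact S -> exists r, forall x, S x -> enorm x <= r.
Proof.
have [-> _|/set0P S0 cS] := eqVneq S set0; first by exists 0.
have [c _ cmax] := compact_max S0 cS (@continuous_dist 0).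
by exists (enorm (c - 0)) => x /cmax; rewrite !subr0.
Qed.

End Topology.

(** * Distance to a set and projections *)

Section Distance.
Context {R : realType} {D : nat}.
Implicit Types (x y z u v c : 'rV[R]_D) (S A B : set 'rV[R]_D).

Lemma edist_to_le S x y : S y -> (edist_to S x <= (enorm (x - y))%:E)%E.
Proof. by move=> Sy; apply: ereal_inf_lbound; exists y. Qed.

Lemma edist_to_ltP S x (t : R) : (edist_to S x < t%:E)%E ->
  exists2 y, S y & enorm (x - y) < t.
Proof.
by move=> /ereal_inf_lt[_ [y Sy <-]]; rewrite lte_fin => xy; exists y.
Qed.

(** Serves sets such as [mu_crit], where the infimum is not known to be attained; it also yields
    that [S] is nonempty. *)
Lemma edist_to_approx S x (t e : R) : (edist_to S x <= t%:E)%E -> 0 < e ->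
  exists2 y, S y & enorm (x - y) < t + e.
Proof.
by move=> xt e0; apply: edist_to_ltP (le_lt_trans xt _); rewrite lte_fin ltrDl.
Qed.

Lemma edist_to_attained S x : S !=set0 -> compact S ->
  exists2 y, S y & edist_to S x = (enorm (x - y))%:E.
Proof.
move=> S0 cS; have [y Sy ymin] := compact_min S0 cS (@continuous_dist _ _ x).
exists y => //; apply/eqP; rewrite eq_le edist_to_le //=.
apply: le_ereal_inf_tmp => _ [w Sw <-]; rewrite lee_fin enormB (enormB x).
exact: ymin.
Qed.

Section Compact.
Variables (S : set 'rV[R]_D) (S0 : S !=set0) (cS : compact S).

Lemma edist_toE x : edist_to S x = (dist_to S x)%:E.
Proof.
by have [y _] := edist_to_attained x S0 cS; rewrite /dist_to => ->.
Qed.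

Lemma dist_to_le x y : S y -> dist_to S x <= enorm (x - y).
Proof. by move=> Sy; rewrite -lee_fin -edist_toE edist_to_le. Qed.

Lemma projections_nonempty x : projections S x !=set0.
Proof.
have [y Sy xy] := edist_to_attained x S0 cS.
by exists y; split => //; rewrite /dist_to xy.
Qed.

Lemma dist_to_ge0 x : 0 <= dist_to S x.
Proof. by have [y [_ <-]] := projections_nonempty x; exact: enorm_ge0. Qed.

Lemma dist_to_gt0 x : ~ S x -> 0 < dist_to S x.
Proof.
move=> Sx; have [y [Sy <-]] := projections_nonempty x.
by apply: enorm_gt0 => /subr0_eq xy; apply: Sx; rewrite xy.
Qed.

Lemma dist_to_lipschitz x y : dist_to S x <= dist_to S y + enorm (x - y).
Proof.
have [p [Sp <-]] := projections_nonempty y.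
by rewrite (le_trans (dist_to_le x Sp)) // [leRHS]addrC enorm_triangle.
Qed.

Lemma continuous_dist_to : continuous (dist_to S).
Proof.
apply: (@enorm_lipschitz_continuous _ _ _ 1) => x y.
by rewrite mul1r lerBlDl dist_to_lipschitz.
Qed.

Lemma compact_projections x : compact (projections S x).
Proof.
have -> : projections S x = S `&` [set y | enorm (y - x) <= dist_to S x].
  apply/seteqP; split => [y [Sy xy]|y [Sy xy]]; split => //=.
    by rewrite enormB xy.
  by apply/eqP; rewrite eq_le dist_to_le // enormB xy.
by apply: compact_closedI => //; exact/closed_sublevel/continuous_dist.
Qed.

End Compact.

Lemma hausdorff_le A B (e : R) : (hausdorff A B <= e%:E)%E ->
  forall y, B y -> (edist_to A y <= e%:E)%E.
Proof.
rewrite /hausdorff ge_max => /andP[_ ABe] y By.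
by apply: le_trans ABe; apply: ereal_sup_ubound; exists y.
Qed.

End Distance.

(** * Smallest enclosing balls *)

Section EnclosingBall.
Context {R : realType} {D : nat}.
Implicit Types (x y z u v c m p : 'rV[R]_D) (S : set 'rV[R]_D).

(** The distance from [c] to its farthest point in [S] is 1-Lipschitz in [c] and large away from
    [S], so it has a minimiser. *)
Lemma ex_seb_center S : S !=set0 -> compact S -> exists c, is_seb_center S c.
Proof.
move=> S0 cS.
have /choice[far farP] c : exists p, S p /\
    forall q, S q -> enorm (q - c) <= enorm (p - c).
  by have [p Sp pmax] := compact_max S0 cS (@continuous_dist _ _ c); exists p.
have far_cont : continuous (fun c => enorm (far c - c)).
  apply: (@enorm_lipschitz_continuous _ _ _ 1) => x y.
  rewrite mul1r lerBlDl (le_trans (enorm_triangle _ y _)) // (enormB y).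
  by rewrite lerD2r; apply: (farP y).2; exact: (farP x).1.
have [q Sq] := S0.
have [|x qx|c cmin] := @ex_min_of_far _ _ _ q (enorm (far q - q)) _ far_cont.
- exact: enorm_ge0.
- by apply: le_trans (ltW qx) _; rewrite enormB; exact: (farP x).2.
exists c, (enorm (far c - c)); split; first exact: (farP c).2.
move=> c' r' /(_ (far c') (farP c').1); exact: le_trans.
Qed.

Lemma seb_centerP S : S !=set0 -> compact S -> is_seb_center S (seb_center S).
Proof. by move=> S0 cS; exact: (xgetPex 0 (ex_seb_center S0 cS)). Qed.

Lemma seb_center1 p : seb_center [set p] = p.
Proof.
have p_nonempty : [set p] !=set0 by exists p.
have [r [pr rmin]] := seb_centerP p_nonempty (@compact_set1 _ p).
have r0 : r <= 0 by apply: (rmin p) => q ->; rewrite subrr enorm0.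
apply/esym/subr0_eq/enorm0_eq0/eqP; rewrite eq_le enorm_ge0 andbT.
exact: le_trans (pr p erefl) r0.
Qed.

(* Compare [m] with the centres [x - s (x - m)], [s < 1]. *)
Lemma seb_center_dot S m x rho : is_seb_center S m ->
    (forall p, S p -> enorm (x - p) = rho) ->
  forall p, S p -> enorm (x - m) ^+ 2 <= dot (x - p) (x - m).
Proof.
move=> [r [mr rmin]] xS p0 Sp0.
(* A point [p] of [S] lies in the ball of centre [m] and radius [r] exactly when [dot (x - p) v] is
   at least [h]. *)
set v := x - m; set V := enorm v ^+ 2; set h := (rho ^+ 2 + V - r ^+ 2) / 2.
have V0 : 0 <= V by exact: sqr_ge0.
have r0 : 0 <= r by exact: le_trans (enorm_ge0 _) (mr _ Sp0).
have dist_s s p : S p ->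
    enorm (p - (x - s *: v)) ^+ 2 =
    s ^+ 2 * V - 2 * s * dot (x - p) v + rho ^+ 2.
  move=> Sp; rewrite -(xS p Sp) /V !enorm_sqr.
  have -> : p - (x - s *: v) = s *: v - (x - p).
    by rewrite !opprB addrCA.
  by rewrite /v !dotE (dotC m x) (dotC p x) (dotC m p); ring.
have hp p : S p -> h <= dot (x - p) v.
  move=> Sp; have : enorm (p - m) ^+ 2 <= r ^+ 2.
    by rewrite ler_sqr ?nnegrE ?enorm_ge0 //; exact: mr.
  have := dist_s 1 p Sp; rewrite scale1r.
  rewrite (_ : x - v = m); last by rewrite /v opprB addrCA subrr addr0.
  move=> ->.
  by rewrite /h -/v => H; rewrite ler_pdivrMr //; lra.
apply: le_trans (hp _ Sp0); rewrite leNgt; apply/negP => hV.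
have key s : 0 <= s -> r ^+ 2 <= s ^+ 2 * V - 2 * s * h + rho ^+ 2.
  move=> s0; set q := (X in _ <= X).
  have dq p : S p -> enorm (p - (x - s *: v)) ^+ 2 <= q.
    move=> Sp; rewrite dist_s // /q.
    have := ler_wpM2l s0 (hp _ Sp); lra.
  have q0 : 0 <= q by exact: le_trans (sqr_ge0 _) (dq _ Sp0).
  rewrite -(sqr_sqrtr q0) ler_sqr ?nnegrE ?sqrtr_ge0 //.
  apply: (rmin (x - s *: v)) => p Sp.
  by rewrite -ler_sqr ?nnegrE ?sqrtr_ge0 ?enorm_ge0 // (sqr_sqrtr q0) dq.
have rE : r ^+ 2 = rho ^+ 2 + V - 2 * h by rewrite /h; field.
(* The quadratic in [s] equals [r ^+ 2] at 1, but over [s >= 0] it is smallest at 0 if [h < 0], and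
   otherwise at [h / V < 1]: both contradict [key]. *)
have [h0|h0] := ltP h 0; first by have := key 0 (lexx 0); rewrite rE; lra.
have Vgt0 : 0 < V by exact: le_lt_trans hV.
have := key (h / V); rewrite divr_ge0 ?rE // => /(_ isT).
have -> : (h / V) ^+ 2 * V - 2 * (h / V) * h = - (h ^+ 2 / V).
  by field; rewrite gt_eqF.
move=> H; have : V - 2 * h + h ^+ 2 / V <= 0 by lra.
have -> : V - 2 * h + h ^+ 2 / V = (V - h) ^+ 2 / V by field; rewrite gt_eqF.
by rewrite leNgt divr_gt0 // exprn_gt0 // subr_gt0.
Qed.

(* Otherwise a small move of [z] in the direction [- u] gives a smaller
   enclosing ball. *)
Lemma seb_center_balanced S z rho : S !=set0 -> compact S ->
    is_seb_center S z -> (forall p, S p -> enorm (z - p) = rho) ->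
  forall u, exists2 p, S p & 0 <= dot u (p - z).
Proof.
move=> S0 cS [r [zr rmin]] zS u.
have [p0 Sp0 p0max] := compact_max S0 cS (@continuous_dotl _ _ u z).
exists p0 => //; rewrite leNgt; apply/negP => neg.
set del := - dot u (p0 - z); have del0 : 0 < del by rewrite oppr_gt0.
set U := dot u u; have U0 : 0 <= U by exact: dot_ge0.
(* This gives [t * U <= del], so the linear gain [2 * t * del] beats [t ^+ 2 * U]; the 1 keeps the
   denominator positive. *)
set t := del / (U + 1).
have t0 : 0 < t by rewrite divr_gt0 // ltr_wpDl.
have tU : t * U <= del.
  rewrite /t mulrAC ler_pdivrMr ?ltr_wpDl // ler_wpM2l ?ltW //; lra.
set q := rho ^+ 2 - 2 * t * del + t ^+ 2 * U.
have dq p : S p -> enorm (p - (z - t *: u)) ^+ 2 <= q.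
  move=> Sp.
  have -> : enorm (p - (z - t *: u)) ^+ 2 =
      enorm (z - p) ^+ 2 + 2 * t * dot u (p - z) + t ^+ 2 * U.
    rewrite !enorm_sqr /U !dotE (dotC z p) (dotC u p) (dotC u z); ring.
  have := ler_wpM2l (ltW t0) (p0max _ Sp).
  by rewrite zS // /q /del; lra.
have q0 : 0 <= q by exact: le_trans (sqr_ge0 _) (dq _ Sp0).
have : q < rho ^+ 2.
  have : t * (t * U) <= t * del by rewrite ler_wpM2l // ltW.
  have : 0 < t * del by rewrite mulr_gt0.
  by rewrite /q; lra.
have rho0 : 0 <= rho by rewrite -(zS _ Sp0) enorm_ge0.
apply/negP; rewrite -leNgt -(sqr_sqrtr q0) ler_sqr ?nnegrE ?sqrtr_ge0 //.
apply: (@le_trans _ _ r); first by rewrite -(zS _ Sp0) enormB zr.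
apply: (rmin (z - t *: u)) => p Sp.
by rewrite -ler_sqr ?nnegrE ?sqrtr_ge0 ?enorm_ge0 // (sqr_sqrtr q0) dq.
Qed.

End EnclosingBall.

(** * Critical and almost critical points of distance functions *)

Section CriticalPoints.
Context {R : realType} {D : nat}.
Implicit Types (x y z u v p : 'rV[R]_D) (M A S : set 'rV[R]_D).

Lemma enorm_grad_dist S x : S !=set0 -> compact S -> ~ S x ->
  enorm (grad_dist S x) =
  enorm (x - seb_center (projections S x)) / dist_to S x.
Proof.
move=> S0 cS Sx; rewrite /grad_dist asboolF // enormZ mulrC ger0_norm //.
by rewrite invr_ge0 dist_to_ge0.
Qed.

(** As [dist_to A z] is nonzero, a zero gradient makes [z] the centre of the smallest ball enclosing
    its projections. *)
Lemma crit_balanced A z : A !=set0 -> compact A -> crit A z ->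
  forall u, exists2 p, projections A z p & 0 <= dot u (p - z).
Proof.
move=> A0 cA [Az]; rewrite /grad_dist asboolF // => /eqP.
rewrite scaler_eq0 invr_eq0 gt_eqF ?dist_to_gt0 //= subr_eq0 => /eqP zE.
have P0 := projections_nonempty A0 cA z.
have cP := compact_projections A0 cA (x := z).
apply: (seb_center_balanced (rho := dist_to A z)) => //.
  by rewrite [X in is_seb_center _ X]zE; exact: seb_centerP.
by move=> p [].
Qed.

(** Law of cosines for a projection [p] of [z] that is not behind [z] in the direction [x - z]. *)
Lemma crit_dist_to_growth A z : A !=set0 -> compact A -> crit A z ->
  forall x, dist_to A x ^+ 2 <= dist_to A z ^+ 2 + enorm (x - z) ^+ 2.
Proof.
move=> A0 cA zcrit x.
have [p [Ap <-] up] := crit_balanced A0 cA zcrit (x - z).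
apply: (@le_trans _ _ (enorm (x - p) ^+ 2)).
  by rewrite ler_sqr ?nnegrE ?enorm_ge0 ?dist_to_ge0 // dist_to_le.
rewrite !enorm_sqr; move: up; rewrite !dotE.
rewrite (dotC z x) (dotC p x) (dotC p z); lra.
Qed.

(** Balance in the direction [z - p0] gives a projection [p] at a non-acute angle from [p0] as seen
    from [z], so [enorm (p - p0)] bounds the distance. *)
Lemma crit_dist_to_le A z r : A !=set0 -> compact A -> crit A z ->
  (forall x, A x -> enorm x <= r) -> dist_to A z <= 2 * r.
Proof.
move=> A0 cA zcrit Ar.
have [p0 [Ap0 zp0]] := projections_nonempty A0 cA z.
have [p [Ap zp] up] := crit_balanced A0 cA zcrit (z - p0).
have r0 : 0 <= r by exact: le_trans (enorm_ge0 _) (Ar _ Ap).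
have pr : enorm (p - p0) <= 2 * r.
  apply: le_trans (enormD _ _) _; rewrite enormN.
  have := Ar _ Ap; have := Ar _ Ap0; lra.
apply: le_trans pr; rewrite -ler_sqr ?nnegrE ?enorm_ge0 ?dist_to_ge0 //.
have -> : enorm (p - p0) ^+ 2 =
    enorm (z - p) ^+ 2 + 2 * dot (z - p0) (p - z) + enorm (z - p0) ^+ 2.
  rewrite !enorm_sqr !dotE (dotC z p) (dotC p0 p) (dotC p0 z); ring.
by rewrite zp zp0; have := sqr_ge0 (dist_to A z); lra.
Qed.

(* The minimum over [M] of the larger of the two excesses is attained, and at
   most [t * C] for every small [t]. *)
Lemma ex_projection_le M x v (a C : R) : M !=set0 -> compact M -> 0 < C ->
    (forall t, 0 < t < 1 -> exists p, [/\ M p,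
      enorm (x - p) ^+ 2 <= dist_to M x ^+ 2 + t * C &
      dot (x - p) v <= a + t * C]) ->
  exists2 p, projections M x p & dot (x - p) v <= a.
Proof.
move=> M0 cM C0 H.
pose f p := Num.max (enorm (p - x) ^+ 2 - dist_to M x ^+ 2)
  (dot (- v) (p - x) - a).
have fle p t : (f p <= t) = (enorm (x - p) ^+ 2 <= dist_to M x ^+ 2 + t) &&
    (dot (x - p) v <= a + t).
  by rewrite /f ge_max !lerBlDl enormB dotNl -dotNr opprB dotC.
have [|||p Mp pmin] := @compact_min _ _ f M => //.
  move=> q; apply: (@continuous_max _ _ (fun p => enorm (p - x) ^+ 2 -
      dist_to M x ^+ 2) (fun p => dot (- v) (p - x) - a)).
    apply: continuousB; last exact: cst_continuous.
    by rewrite (_ : (fun _ => _) = (fun p => enorm (p - x) * enorm (p - x))) //;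
       apply: continuousM; exact: continuous_dist.
  apply: continuousB; last exact: cst_continuous.
  exact: continuous_dotl.
have : f p <= 0.
  rewrite leNgt; apply/negP => fp.
  have den : 0 < f p + 2 * C by lra.
  (* This [t] is below 1 and makes [t * C] smaller than [f p], against the minimality of [p]. *)
  have [|q [Mq q1 q2]] := H (f p / (f p + 2 * C)).
    rewrite divr_gt0 //= ltr_pdivrMr //; lra.
  have : f p <= f p / (f p + 2 * C) * C.
    by apply: le_trans (pmin _ Mq) _; rewrite fle q1 q2.
  rewrite mulrAC ler_pdivlMr // ler_pM2l //; lra.
rewrite fle !addr0 => /andP[p1 p2]; exists p => //; split=> //.
apply/eqP; rewrite eq_le dist_to_le // andbT.
by rewrite -ler_sqr ?nnegrE ?enorm_ge0 ?dist_to_ge0.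
Qed.

(* The point [x] maximises [d_M^2 - 2 |. - z|^2]; comparing with the ascent
   direction [v = x - m] bounds [|v|]. *)
Lemma ex_almost_crit M z b : M !=set0 -> compact M -> 0 <= b ->
    (forall x, dist_to M x ^+ 2 <=
       dist_to M z ^+ 2 + b ^+ 2 + enorm (x - z) ^+ 2) ->
  exists x, [/\ enorm (x - z) <= b, dist_to M z <= dist_to M x &
    enorm (x - seb_center (projections M x)) <= 2 * b].
Proof.
move=> M0 cM b0 H.
pose f x := 2 * (enorm (x - z) * enorm (x - z)) - dist_to M x * dist_to M x.
have fE x : f x = 2 * enorm (x - z) ^+ 2 - dist_to M x ^+ 2 by [].
have fcont : continuous f.
  move=> y; have cd := @continuous_dist _ _ z y.
  have cM' := @continuous_dist_to _ _ _ M0 cM y.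
  exact: (cvgB (cvgM (cvg_cst (2 : R)) (cvgM cd cd)) (cvgM cM' cM')).
(* By [H], [f x] is at least [enorm (x - z) ^+ 2 - b ^+ 2 - dist_to M z ^+ 2], hence at least [f z]
   beyond distance [b]. *)
have [x bx|x xmin] := @ex_min_of_far _ _ f z b b0 fcont.
  rewrite !fE subrr enorm0.
  have : b ^+ 2 <= enorm (x - z) ^+ 2.
    by rewrite ler_sqr ?nnegrE ?enorm_ge0 // ltW.
  by have := H x; lra.
have fz := xmin z; rewrite !fE subrr enorm0 in fz.
have xz : enorm (x - z) <= b.
  by rewrite -ler_sqr ?nnegrE ?enorm_ge0 //; have := H x; lra.
exists x; split=> //.
  rewrite -ler_sqr ?nnegrE ?dist_to_ge0 //.
  by have := sqr_ge0 (enorm (x - z)); lra.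
set m := seb_center _; set v := x - m.
have [B MB] := compact_ebounded cM.
(* [C] dominates, for all [t] in (0, 1), the coefficients of [t] in both bounds below. *)
pose C := 1 + 4 * `|dot (x - z) v| + 2 * (enorm x + B) * enorm v + enorm v ^+ 2.
have B0 : 0 <= B.
  by have [q Mq] := M0; exact: le_trans (enorm_ge0 _) (MB _ Mq).
have ev0 := enorm_ge0 v; have ex0 := enorm_ge0 x.
have C0 : 0 < C.
  by rewrite /C -!addrA ltr_pwDl // !addr_ge0 ?sqr_ge0 ?mulr_ge0 ?addr_ge0.
have [|p [Mp xp] pv] := @ex_projection_le M x v (2 * dot (x - z) v) C M0 cM C0.
  move=> t /andP[t0 t1].
  have [p [Mp xtp]] := projections_nonempty M0 cM (x + t *: v).
  exists p.
  (* Comparing [x] with [x + t *: v] gives [|x - p|^2 + 2 t <x - p, v> <= d_M(x)^2 + 4 t <x - z, v>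
     + t^2 |v|^2]. *)
  have fxt := xmin (x + t *: v).
  rewrite !fE -xtp !sqdistD enormZ dotZr (dotZr t) in fxt.
  rewrite (ger0_norm (ltW t0)) exprMn in fxt.
  have dp : dist_to M x ^+ 2 <= enorm (x - p) ^+ 2.
    by rewrite ler_sqr ?nnegrE ?enorm_ge0 ?dist_to_ge0 // dist_to_le.
  have V0 := sqr_ge0 (enorm v).
  have tV : t ^+ 2 * enorm v ^+ 2 <= t * enorm v ^+ 2.
    by rewrite ler_wpM2r // expr2 ler_piMr // ltW.
  have pvB : - dot (x - p) v <= (enorm x + B) * enorm v.
    rewrite -dotNl; apply: le_trans (dot_le _ _) _; rewrite enormN ler_wpM2r //.
    by rewrite (le_trans (enormD _ _)) // enormN lerD2l MB.
  have zv : dot (x - z) v <= `|dot (x - z) v| := ler_norm _.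
  have Q0 : 0 <= (enorm x + B) * enorm v by rewrite mulr_ge0 // addr_ge0.
  split=> //.
  - apply: (@le_trans _ _ (dist_to M x ^+ 2 +
      t * (4 * dot (x - z) v - 2 * dot (x - p) v + enorm v ^+ 2))); first lra.
    by rewrite lerD2l ler_pM2l // /C; lra.
  - have H1 : t * (2 * dot (x - p) v) <=
        t * (4 * dot (x - z) v + t * enorm v ^+ 2).
      by rewrite !mulrDr; lra.
    have tC : t * enorm v ^+ 2 <= t * C.
      rewrite ler_pM2l // /C; have := normr_ge0 (dot (x - z) v); lra.
    have tV0 : 0 <= t * enorm v ^+ 2 by rewrite mulr_ge0 // ltW.
    rewrite ler_pM2l // in H1; lra.
(* The chain is [|v|^2 <= <x - p, v> <= 2 <x - z, v> <= 2 b |v|]. *)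
have := seb_center_dot (seb_centerP (projections_nonempty M0 cM x)
  (compact_projections M0 cM (x := x))) (fun p Pp => Pp.2) (conj Mp xp).
rewrite -/m -/v => vv.
have [v0|v0] := eqVneq (enorm v) 0; first by rewrite v0 mulr_ge0.
have vpos : 0 < enorm v by rewrite lt_def v0.
rewrite -(ler_pM2r vpos) -expr2 (le_trans vv) // (le_trans pv) //.
rewrite -mulrA ler_pM2l // (le_trans (dot_le _ _)) // ler_wpM2r //.
Qed.

End CriticalPoints.

(** * Derivatives along segments *)

Section Calculus.
Context {R : realType} {D : nat}.
Implicit Types (x y z v w : 'rV[R]_D) (U : set 'rV[R]_D).
Implicit Types f : 'rV[R]_D -> 'rV[R]_D.

Lemma near_eball x (P : set 'rV[R]_D) : (\forall y \near x, P y) ->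
  exists2 r, 0 < r & forall y, enorm (y - x) < r -> P y.
Proof.
move=> /nbhs_ballP[r /= r0 rP]; exists r => // y yx; apply: rP.
by rewrite -ball_normE /= distrC (le_lt_trans (norm_le_enorm _)).
Qed.

Lemma eball_near x r : 0 < r -> \forall y \near x, enorm (y - x) < r.
Proof.
move=> r0; have := @continuous_dist _ _ x x.
by move=> /cvgr_lt; apply; rewrite subrr enorm0.
Qed.

Lemma eball_convex x y c r t : 0 <= t <= 1 ->
  enorm (x - c) < r -> enorm (y - c) < r -> enorm (x + t *: (y - x) - c) < r.
Proof.
move=> /andP[t0 t1] xr yr.
have -> : x + t *: (y - x) - c = (1 - t) *: (x - c) + t *: (y - c).
  by apply/rowP => i; rewrite !mxE; ring.
apply: le_lt_trans (enormD _ _) _; rewrite !enormZ !ger0_norm ?subr_ge0 //.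
have [->|tne0] := eqVneq t 0; first by rewrite subr0 mul1r mul0r addr0.
have tp : 0 < t by rewrite lt_def tne0.
have := ler_wpM2l (_ : 0 <= 1 - t) (ltW xr); rewrite subr_ge0 => /(_ t1).
have := yr; rewrite -(ltr_pM2l tp); lra.
Qed.

Lemma is_derive_line f x v t : differentiable f (x + t *: v) ->
  is_derive t 1 (fun s : R => f (x + s *: v)) ('D_v f (x + t *: v)).
Proof.
move=> df.
have E : (fun h : R =>
      h^-1 *: (((fun s => f (x + s *: v)) \o shift t) (h *: 1)
      - f (x + t *: v))) =
    (fun h : R =>
      h^-1 *: ((f \o shift (x + t *: v)) (h *: v) - f (x + t *: v))).
  apply/funext => h /=; congr (_ *: (f _ - _)).
  by rewrite [h *: 1]mulr1 scalerDl addrCA.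
have dv : derivable f (x + t *: v) v := diff_derivable df.
by apply: DeriveDef; [rewrite /derivable E | rewrite /derive E].
Qed.

(** The scalar mean value theorem, one coordinate at a time: the intermediate [t] depends on [i]. *)
Lemma mvt_coord f x v i :
    (forall t : R, 0 <= t <= 1 -> differentiable f (x + t *: v)) ->
  exists2 t, 0 <= t <= 1 &
    (f (x + v) - f x) 0 i = ('D_v f (x + t *: v)) 0 i.
Proof.
move=> df.
have dfi (t : R) : 0 <= t <= 1 -> is_derive t 1 (fun s => f (x + s *: v) 0 i)
    (('D_v f (x + t *: v)) 0 i).
  move=> /df /is_derive_line[dl dE]; apply: DeriveDef.
    by have /derivable_mxP := dl; apply.
  by rewrite -dE (derive_mx dl) mxE.
have [||t t01 tE] := @MVT_segment R (fun s => f (x + s *: v) 0 i)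
  (fun s => ('D_v f (x + s *: v)) 0 i) 0 1 ler01.
- by move=> t; rewrite in_itv /= => /andP[t0 t1]; apply: dfi; rewrite !ltW.
- apply: derivable_within_continuous => t; rewrite in_itv /= => t01.
  by have [] := dfi t t01.
exists t; first by move: t01; rewrite in_itv.
by move: tE; rewrite !scale0r !scale1r addr0 subr0 mulr1 !mxE.
Qed.

(** Reduces all directions to finitely many partial derivatives, so continuity in each fixed
    direction gives bounds uniform in [v]. *)
Lemma derive_sum_delta f x v i : differentiable f x ->
  ('D_v f x) 0 i = \sum_k v 0 k * ('D_(delta_mx 0 k) f x) 0 i.
Proof.
move=> df; rewrite deriveE // {1}(row_sum_delta v) linear_sum summxE.
by apply: eq_bigr => k _; rewrite linearZ deriveE // mxE.
Qed.

End Calculus.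

(** * Local Lipschitz and Taylor bounds *)

Section LocalEstimates.
Context {R : realType} {D : nat}.
Implicit Types (x y z v w : 'rV[R]_D) (U : set 'rV[R]_D).
Implicit Types f : 'rV[R]_D -> 'rV[R]_D.

Lemma norm_sum_scale_le v (g : 'I_D -> R) (B : 'I_D -> R) :
  (forall k, `|g k| <= B k) ->
  `|\sum_k v 0 k * g k| <= (\sum_k B k) * enorm v.
Proof.
move=> gB; apply: le_trans (ler_norm_sum _ _ _) _; rewrite mulr_suml.
apply: ler_sum => k _; rewrite normrM mulrC.
by rewrite ler_pM // enorm_coord.
Qed.

Lemma C1_on_lipschitz U f c : open U -> C1_on U f -> U c ->
  exists L, [/\ 0 < L & \forall r \near (0 : R)^'+, forall x y,
    enorm (x - c) < r -> enorm (y - c) < r ->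
    U x /\ enorm (f y - f x) <= L * enorm (y - x)].
Proof.
move=> oU [df cf] Uc.
pose B (k : 'I_D) := `|'D_(delta_mx 0 k) f c| + 1.
have nB : \forall y \near c, U y /\ forall k, `|'D_(delta_mx 0 k) f y| <= B k.
  have nU : \forall y \near c, U y by exact: open_nbhs_nbhs.
  have nk : \forall y \near c, forall k, `|'D_(delta_mx 0 k) f y| <= B k.
    apply: (@filter_forall _ _
      (fun k y => `|'D_(delta_mx 0 k) f y| <= B k) (nbhs c)) => k.
    have Bk : `|'D_(delta_mx 0 k) f c| < B k by rewrite ltrDl.
    exact: (cvgr_norm_le _ (cf (delta_mx 0 k) c Uc) _ Bk).
  by apply: filterS2 nU nk.
have [r0 r00 r0P] := near_eball nB.
have B0 : 0 <= \sum_k B k by apply: sumr_ge0 => k _; rewrite addr_ge0.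
exists (D%:R * (\sum_k B k) + 1); split.
  by rewrite ltr_wpDl // mulr_ge0.
near=> r => x y xr yr.
have rr0 : r <= r0 by near: r; exact: nbhs_right_le.
have xr0 := lt_le_trans xr rr0; have yr0 := lt_le_trans yr rr0.
split; first by have [] := r0P _ xr0.
apply: (@le_trans _ _ (D%:R * ((\sum_k B k) * enorm (y - x)))); last first.
  by rewrite mulrA ler_wpM2r ?enorm_ge0 // lerDl.
apply: enorm_le_coord => [|i]; first by rewrite mulr_ge0 ?enorm_ge0.
have line t : 0 <= t <= 1 -> enorm (x + t *: (y - x) - c) < r0.
  by move=> t01; exact: eball_convex.
have [|t t01] := @mvt_coord _ _ f x (y - x) i.
  by move=> t /line /r0P[/df].
rewrite (addrC x) subrK => ->; have [Ut Bt] := r0P _ (line t t01).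
rewrite (derive_sum_delta _ _ (df _ Ut)).
apply: norm_sum_scale_le => k; apply: le_trans (Bt k).
exact: coord_le_norm.
Unshelve. all: by end_near. Qed.

(** Each coordinate of the remainder combines increments of partial derivatives between [x] and a
    point of the segment, which [C1_on_lipschitz] controls. *)
Lemma C2_on_taylor U f c : open U -> C2_on U f -> U c ->
  exists L, [/\ 0 < L & \forall r \near (0 : R)^'+, forall x y,
    enorm (x - c) < r -> enorm (y - c) < r ->
    U x /\ enorm (f y - f x - 'D_(y - x) f x) <= L * enorm (y - x) ^+ 2].
Proof.
move=> oU [[df cf] d2f] Uc.
have /choice[L LP] (k : 'I_D) := C1_on_lipschitz oU (d2f (delta_mx 0 k)) Uc.
have L0 k : 0 <= L k by rewrite ltW // (LP k).1.
have SL0 : 0 <= \sum_k L k by apply: sumr_ge0.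
have nU : \forall y \near c, U y by exact: open_nbhs_nbhs.
have [r0 r00 r0P] := near_eball nU.
exists (D%:R * (\sum_k L k) + 1); split.
  by rewrite ltr_wpDl // mulr_ge0.
have nL : \forall r \near (0 : R)^'+, forall k x y,
    enorm (x - c) < r -> enorm (y - c) < r ->
    U x /\ enorm ('D_(delta_mx 0 k) f y - 'D_(delta_mx 0 k) f x)
      <= L k * enorm (y - x).
  by apply: filter_forall => k; have [] := LP k.
near=> r => x y xr yr.
have rr0 : r <= r0 by near: r; exact: nbhs_right_le.
have rL k x' y' : enorm (x' - c) < r -> enorm (y' - c) < r -> U x' /\
    enorm ('D_(delta_mx 0 k) f y' - 'D_(delta_mx 0 k) f x') <=
    L k * enorm (y' - x').
  by move: k x' y'; near: r.
have Ux : U x by apply/r0P/(lt_le_trans xr).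
split=> //.
apply: (@le_trans _ _
  (D%:R * ((\sum_k L k * enorm (y - x)) * enorm (y - x)))); last first.
  rewrite -mulr_suml -mulrA -expr2 mulrA ler_wpM2r ?sqr_ge0 // lerDl //.
have v0 := enorm_ge0 (y - x).
apply: enorm_le_coord => [|i].
  by rewrite mulr_ge0 // sumr_ge0 // => k _; rewrite mulr_ge0.
have line t : 0 <= t <= 1 -> enorm (x + t *: (y - x) - c) < r.
  by move=> t01; exact: eball_convex.
have Uline t : 0 <= t <= 1 -> U (x + t *: (y - x)).
  by move=> /line tr; apply/r0P/(lt_le_trans tr).
have [|t t01] := @mvt_coord _ _ f x (y - x) i.
  by move=> t /Uline /df.
rewrite (addrC x) subrK => E; rewrite mxE E.
rewrite [X in _ + X]mxE.
rewrite (derive_sum_delta _ _ (df _ (Uline t t01))).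
rewrite (derive_sum_delta _ _ (df _ Ux)).
rewrite -sumrB; under eq_bigr do rewrite -mulrBr.
apply: norm_sum_scale_le => k.
have [_ H] := rL k x _ xr (line t t01).
have := enorm_coord ('D_(delta_mx 0 k) f (x + t *: (y - x)) -
  'D_(delta_mx 0 k) f x) i.
rewrite mxE [X in _ + X]mxE => /le_trans; apply; apply: le_trans H _.
rewrite ler_wpM2l // (addrC x) addrK enormZ ger0_norm; last by case/andP: t01.
by rewrite ler_piMl //; case/andP: t01.
Unshelve. all: by end_near. Qed.

End LocalEstimates.

(** * Positive reach of a compact C^2 submanifold *)

Section Reach.
Context {R : realType} {D : nat}.
Implicit Types (x y z v w a p q : 'rV[R]_D) (M : set 'rV[R]_D).

(** At [t = tau * s] with [tau * C <= 1 / 2], the positive number [tau * s ^+ 2] would be at most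
    half of itself. *)
Lemma orthogonal_of_first_order (s C del : R) : 0 < C -> 0 < del ->
  (forall t, `|t| < del -> t * s <= C * t ^+ 2) -> s = 0.
Proof.
move=> C0 del0 H; apply/eqP; apply: contraT => s0.
have ns : 0 < `|s| by rewrite normr_gt0.
pose tau := Num.min (del / (2 * `|s|)) (1 / (2 * C)).
have tau0 : 0 < tau by rewrite lt_min !divr_gt0 // mulr_gt0.
have tau1 : tau * (2 * `|s|) <= del.
  by rewrite -ler_pdivlMr ?mulr_gt0 // ge_min lexx.
have tau2 : tau * (2 * C) <= 1.
  by rewrite -ler_pdivlMr ?mulr_gt0 // ge_min lexx orbT.
have := H (tau * s); rewrite normrM (gtr0_norm tau0).
have -> : tau * `|s| < del by have := mulr_gt0 tau0 ns; lra.
move=> /(_ isT); rewrite exprMn.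
have s2 : 0 < s ^+ 2 by rewrite exprn_even_gt0.
have P : 0 < tau * s ^+ 2 by rewrite mulr_gt0.
have -> : C * (tau ^+ 2 * s ^+ 2) = (tau * C) * (tau * s ^+ 2) by ring.
have -> : tau * s * s = tau * s ^+ 2 by ring.
have := ler_wpM2r (ltW P) (_ : tau * C <= 2^-1).
have -> : tau * C <= 2^-1 by lra.
move=> /(_ isT); lra.
Qed.

(* [y] minimises the distance to [z] along the image in [M] of a segment of the
   chart through [phi y], so the velocity there is orthogonal to [z - y]; the
   rest of [a - y] is a second order Taylor remainder. *)
Lemma chart_almost_orthogonal d M c : C2_submanifold d M -> M c ->
  exists r C, [/\ 0 < r, 0 < C & forall y a z,
    M y -> M a -> enorm (y - c) < r -> enorm (a - c) < r ->
    (forall q, M q -> enorm (z - y) <= enorm (z - q)) ->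
    `|dot (a - y) (z - y)| <= C * enorm (a - y) ^+ 2 * enorm (z - y)].
Proof.
move=> [_ chart] /chart[U [phi [psi [Uc [oU oV C2phi C2psi psiK] MU]]]].
have Vc : (phi @` U) (phi c) by exists c.
have [L1 [L1_gt0 taylor]] := C2_on_taylor oV C2psi Vc.
have [L2 [L2_gt0 lipschitz]] := C1_on_lipschitz oU C2phi.1 Uc.
have [r1 [r1_gt0 r1P]] : exists r, 0 < r /\ forall x y,
    enorm (x - phi c) < r -> enorm (y - phi c) < r ->
    (phi @` U) x /\
    enorm (psi y - psi x - 'D_(y - x) psi x) <= L1 * enorm (y - x) ^+ 2.
  have [r rP] := filter_ex (filterI (nbhs_right_gt (0 : R)) taylor).
  by exists r; case: rP.
have [r2 [r2_gt0 r2P]] : exists r, 0 < r /\ forall x y,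
    enorm (x - c) < r -> enorm (y - c) < r ->
    U x /\ enorm (phi y - phi x) <= L2 * enorm (y - x).
  have [r rP] := filter_ex (filterI (nbhs_right_gt (0 : R)) lipschitz).
  by exists r; case: rP.
(* The radius [r1 / L2] makes [phi] send the ball into the Taylor ball around [phi c]. *)
exists (Num.min r2 (r1 / L2)), (L1 * L2 ^+ 2); split.
- by rewrite lt_min r2_gt0 divr_gt0.
- by rewrite mulr_gt0 ?exprn_gt0.
move=> y a z My Ma; rewrite !lt_min => /andP[yr2 yr1] /andP[ar2 ar1] ymin.
have cr2 : enorm (c - c) < r2 by rewrite subrr enorm0.
have [Uy _] := r2P _ _ yr2 cr2; have [Ua _] := r2P _ _ ar2 cr2.
have [_ ylip] := r2P _ _ cr2 yr2; have [_ alip] := r2P _ _ cr2 ar2.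
rewrite ltr_pdivlMr // mulrC in yr1; rewrite ltr_pdivlMr // mulrC in ar1.
have yr := le_lt_trans ylip yr1; have ar := le_lt_trans alip ar1.
set w := phi a - phi y; set v := 'D_w psi (phi y); set u := z - y.
have [_ wlip] := r2P _ _ yr2 ar2; rewrite -/w in wlip.
have dpsi : differentiable psi (phi y) by apply: C2psi.1.1; exists y.
have [_ rem] := r1P _ _ yr ar; rewrite !psiK // -/w -/v in rem.
(* Then only the Taylor remainder [a - y - v] contributes to [dot (a - y) u]. *)
suff vu : dot v u = 0.
  have -> : dot (a - y) u = dot (a - y - v) u by rewrite [RHS]dotBl vu subr0.
  apply: le_trans (cauchy_schwarz _ _) _; rewrite ler_wpM2r ?enorm_ge0 //.
  apply: le_trans rem _; rewrite -mulrA ler_pM2l // -exprMn.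
  by rewrite ler_sqr // nnegrE ?mulr_ge0 ?enorm_ge0 // ltW.
set W := enorm w ^+ 2; have W0 : 0 <= W by exact: sqr_ge0.
pose C := L1 * W * enorm u + enorm v ^+ 2 + (L1 * W) ^+ 2 + 1.
(* The bound 1 gives [t ^+ 2 <= 1]; the other keeps [phi y + t *: w] in the Taylor ball. *)
pose del := Num.min 1 ((r1 - enorm (phi y - phi c)) / (enorm w + 1)).
have w1 : 0 < enorm w + 1 by rewrite ltr_wpDl ?enorm_ge0.
apply: (@orthogonal_of_first_order _ C del).
- by rewrite /C ltr_wpDl // !addr_ge0 ?sqr_ge0 ?mulr_ge0 ?enorm_ge0 // ltW.
- by rewrite lt_min ltr01 divr_gt0 // subr_gt0.
move=> t; rewrite lt_min => /andP[t1]; rewrite ltr_pdivlMr // => t2.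
set e := phi y + t *: w.
have er : enorm (e - phi c) < r1.
  rewrite /e addrAC; apply: le_lt_trans (enormD _ _) _; rewrite enormZ.
  by have := normr_ge0 t; lra.
have [[q Uq qe] _] := r1P _ _ er yr.
(* The coordinates of index at least [d] vanish for [phi y] and [phi a], hence along their line. *)
have Mq : M q.
  apply/MU => // i di; rewrite qe /e /w !mxE.
  by rewrite ((MU _ Uy).1 My _ di) ((MU _ Ua).1 Ma _ di); ring.
have [_] := r1P _ _ yr er; rewrite -qe !psiK // qe /e (addrC (phi y)) addrK.
have -> : 'D_(t *: w) psi (phi y) = t *: v by rewrite /v !deriveE // linearZ.
set g := q - y - t *: v => gle.
have qyE : q - y = g + t *: v by rewrite /g subrK.
rewrite enormZ exprMn real_normK ?num_real // -/W in gle.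
have : enorm (z - y) ^+ 2 <= enorm (z - q) ^+ 2.
  by rewrite ler_sqr ?nnegrE ?enorm_ge0 // ymin.
have -> : enorm (z - q) ^+ 2 =
    enorm (z - y) ^+ 2 - 2 * dot (q - y) u + enorm (q - y) ^+ 2.
  rewrite !enorm_sqr /u !dotE (dotC q z) (dotC y z) (dotC q y); ring.
have gu : - dot g u <= L1 * W * t ^+ 2 * enorm u.
  rewrite -dotNl; apply: le_trans (dot_le _ _) _.
  rewrite enormN ler_wpM2r ?enorm_ge0 //.
  by rewrite mulrAC -mulrA mulrCA mulrC; lra.
have g2 : enorm g ^+ 2 <= (L1 * W) ^+ 2 * t ^+ 2.
  have t21 : t ^+ 2 <= 1.
    by rewrite -real_normK ?num_real // exprn_ile1 // ltW.
  apply: (@le_trans _ _ ((L1 * (t ^+ 2 * W)) ^+ 2)).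
    by rewrite ler_sqr ?nnegrE ?enorm_ge0 // (le_trans (enorm_ge0 _) gle).
  have -> : (L1 * (t ^+ 2 * W)) ^+ 2 = (L1 * W) ^+ 2 * t ^+ 2 * t ^+ 2 by ring.
  by rewrite ler_piMr // mulr_ge0 ?sqr_ge0.
have : enorm (q - y) ^+ 2 <= 2 * enorm g ^+ 2 + 2 * (t ^+ 2 * enorm v ^+ 2).
  have := enormD_sqr_le g (t *: v).
  by rewrite -qyE enormZ exprMn real_normK ?num_real.
have tt := sqr_ge0 t; have Ct : C * t ^+ 2 = L1 * W * t ^+ 2 * enorm u +
    enorm v ^+ 2 * t ^+ 2 + (L1 * W) ^+ 2 * t ^+ 2 + t ^+ 2 by rewrite /C; ring.
have dq : dot (q - y) u = dot g u + t * dot v u.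
  by rewrite qyE [LHS]dotDl (dotZl t v).
by rewrite Ct dq; lra.
Qed.

(* Federer's characterisation of reach at least [1 / (2 K)]. *)
Definition reach_bound (K : R) M := forall z y a, projections M z y -> M a ->
  `|dot (a - y) (z - y)| <= K * enorm (a - y) ^+ 2 * dist_to M z.

(** For [y] near [c], the chart estimate handles [a] near [c]; for other [a], Cauchy-Schwarz
    suffices once [K * enorm (a - y) >= 1]. Both persist for larger [K], so compactness gives one
    constant. *)
Lemma ex_reach_bound d M : compact M -> C2_submanifold d M ->
  exists2 K, 0 < K & reach_bound K M.
Proof.
move=> cM subM.
pose P (K : R) y := forall z a, M a ->
    (forall q, M q -> enorm (z - y) <= enorm (z - q)) ->
    `|dot (a - y) (z - y)| <= K * enorm (a - y) ^+ 2 * enorm (z - y).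
have : \forall K \near +oo, M `<=` P K.
  have /near_covering_withinP cov : near_covering M.
    exact/compact_near_coveringP.
  apply: cov => c Mc.
  have [r [C [r0 C0 rC]]] := chart_almost_orthogonal subM Mc.
  have r20 : 0 < r / 2 by rewrite divr_gt0.
  near=> y K => My z a Ma ymin.
  have yr : enorm (y - c) < r / 2 by near: y; exact: eball_near.
  have CK : C <= K by near: K; apply: nbhs_pinfty_ge; exact: num_real.
  have rK : (r / 2)^-1 <= K by near: K; apply: nbhs_pinfty_ge; exact: num_real.
  have [ar|ar] := ltP (enorm (a - c)) r.
    apply: le_trans (rC y a z My Ma _ ar ymin) _; first lra.
    by rewrite !ler_wpM2r ?sqr_ge0 ?enorm_ge0.
  apply: le_trans (cauchy_schwarz _ _) _; rewrite ler_wpM2r ?enorm_ge0 //.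
  have ay : r / 2 <= enorm (a - y) by have := enorm_triangle a y c; lra.
  rewrite expr2 mulrA ler_peMl ?enorm_ge0 //.
  by rewrite -(mulVf (lt0r_neq0 r20)) ler_pM // ?invr_ge0 ltW.
move=> /(filterI (nbhs_pinfty_gt (num_real (0 : R))))/filter_ex[K [K0 KP]].
exists K => // z y a [My zy] Ma; rewrite -zy; apply: KP => // q Mq.
by rewrite zy dist_to_le //; exists y.
Unshelve. all: by end_near. Qed.

End Reach.

(** Yields a single growth constant valid at all critical points of [M] under (P2). *)
Lemma near_finite_set (T : choiceType) (I : Type) (F : set_system I) (S : set T)
    (P : T -> I -> Prop) : Filter F -> finite_set S ->
    (forall t, S t -> \forall i \near F, P t i) ->
  \forall i \near F, forall t, S t -> P t i.
Proof.
move=> FF /finite_seqP[s ->]; elim: s => [|t s IHs] H.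
  by apply: filterE => i t.
have Ht := H t (mem_head t s).
have Hs : \forall i \near F, forall u, [set` s] u -> P u i.
  by apply: IHs => u us; apply: H; rewrite /= inE us orbT.
apply: filterS2 Ht Hs => i Pti Psi u; rewrite /= inE => /orP[/eqP -> //|].
exact: Psi.
Qed.

(** * Critical points and projections of a dense sample *)

Section Sampling.
Context {R : realType} {D : nat}.
Implicit Types (x y z p q : 'rV[R]_D) (M A : set 'rV[R]_D) (K e : R).

(** Expand [enorm (z - a) ^+ 2] around a projection [y] of [z], with [a] in [A] close to [y]; the
    reach bound makes the cross term quadratic in [e]. *)
Lemma dist_to_sample K M A e z : M !=set0 -> compact M -> A !=set0 ->
    compact A -> A `<=` M -> reach_bound K M -> 0 <= K ->
    (forall y, M y -> exists2 a, A a & enorm (y - a) <= e) ->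
  dist_to A z ^+ 2 <=
    dist_to M z ^+ 2 + (1 + 2 * K * dist_to M z) * e ^+ 2.
Proof.
move=> M0 cM A0 cA AM KM K0 dense.
have [y Py] := projections_nonempty M0 cM z; have [My zy] := Py.
have [a Aa ya] := dense y My.
apply: (@le_trans _ _ (enorm (z - a) ^+ 2)).
  by rewrite ler_sqr ?nnegrE ?enorm_ge0 ?dist_to_ge0 // dist_to_le.
have -> : enorm (z - a) ^+ 2 =
    dist_to M z ^+ 2 - 2 * dot (a - y) (z - y) + enorm (a - y) ^+ 2.
  rewrite -zy !enorm_sqr !dotE (dotC a z) (dotC y z) (dotC y a); ring.
have := KM z y a Py (AM _ Aa); rewrite ler_norml => /andP[lo _].
have ae : enorm (a - y) ^+ 2 <= e ^+ 2.
  by rewrite ler_sqr ?nnegrE ?enorm_ge0 ?(le_trans (enorm_ge0 _) ya) // enormB.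
have d0 := dist_to_ge0 M0 cM z.
have := ler_wpM2l (_ : 0 <= 1 + 2 * K * dist_to M z) ae.
have -> : 0 <= 1 + 2 * K * dist_to M z by rewrite addr_ge0 ?mulr_ge0.
by move=> /(_ isT); lra.
Qed.

(* Among the projections of [z] on [A], take one that is not behind [z] as seen
   from the projection of [z] on [M]. *)
Lemma crit_near K M A b z : M !=set0 -> compact M -> A !=set0 ->
    compact A -> A `<=` M -> reach_bound K M -> 0 < K -> crit A z -> 0 <= b ->
    dist_to A z ^+ 2 <= dist_to M z ^+ 2 + b -> 4 * K * dist_to M z <= 1 ->
  dist_to M z <= 2 * K * b.
Proof.
move=> M0 cM A0 cA AM KM K0 zcrit b0 rb dK.
have d0 := dist_to_ge0 M0 cM z.
have [y Py] := projections_nonempty M0 cM z; have [My zy] := Py.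
have [p [Ap zp] up] := crit_balanced A0 cA zcrit (z - y).
have [dz|dz] := eqVneq (dist_to M z) 0.
  by rewrite dz mulr_ge0 // mulr_ge0 // ltW.
have dpos : 0 < dist_to M z by rewrite lt_def dz.
have := KM z y p Py (AM _ Ap); rewrite ler_norml => /andP[_].
set be := dot (z - y) (p - z) in up.
have -> : dot (p - y) (z - y) = be + dist_to M z ^+ 2.
  rewrite /be -zy enorm_sqr !dotE (dotC p z) (dotC y z) (dotC p y); ring.
have -> : enorm (p - y) ^+ 2 = dist_to A z ^+ 2 + dist_to M z ^+ 2 + 2 * be.
  rewrite /be -zy -zp !enorm_sqr !dotE (dotC p z) (dotC y z) (dotC p y); ring.
set dM := dist_to M z in d0 dz dpos rb dK *; set dA := dist_to A z in rb *.
move=> H.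
(* On the right of [H], the contribution of [be] is at most [be / 2], which [be] on the left
   absorbs. *)
have beK : be * (4 * K * dM) <= be by rewrite ler_piMr.
have H1 : dM * dM <= dM * (K * (dA ^+ 2 + dM ^+ 2)) by lra.
rewrite ler_pM2l // in H1.
have H2 : K * (dA ^+ 2 + dM ^+ 2) <= K * (2 * dM ^+ 2 + b).
  by rewrite ler_pM2l //; lra.
have H3 : dM * (4 * K * dM) <= dM by rewrite ler_piMr.
lra.
Qed.

(** Apply [ex_almost_crit] with [b = c * e]: [1 <= c] gives [c * e ^+ 2 <= b ^+ 2], and dividing by
    [dist_to M x >= dist_to M z] bounds the gradient. *)
Lemma crit_far M A c e z : M !=set0 -> compact M -> A !=set0 -> compact A ->
    A `<=` M -> crit A z -> 1 <= c -> 0 <= e -> 0 < dist_to M z ->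
    dist_to A z ^+ 2 <= dist_to M z ^+ 2 + c * e ^+ 2 ->
  exists2 x, mu_crit (2 * (c * e) / dist_to M z) M x & enorm (z - x) <= c * e.
Proof.
move=> M0 cM A0 cA AM zcrit c1 e0 dz rb.
have c0 : 0 <= c by exact: le_trans c1.
have ce0 : 0 <= c * e by rewrite mulr_ge0.
have [x [xz dx vx]] : exists x, [/\ enorm (x - z) <= c * e,
    dist_to M z <= dist_to M x &
    enorm (x - seb_center (projections M x)) <= 2 * (c * e)].
  apply: ex_almost_crit => // x.
  have := crit_dist_to_growth A0 cA zcrit x.
  have : dist_to M x ^+ 2 <= dist_to A x ^+ 2.
    rewrite ler_sqr ?nnegrE ?dist_to_ge0 //.
    have [p [Ap <-]] := projections_nonempty A0 cA x.
    exact/dist_to_le/AM.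
  have : c * e ^+ 2 <= (c * e) ^+ 2.
    by rewrite exprMn ler_wpM2r ?sqr_ge0 // expr2 ler_peMr.
  by move: rb; lra.
have dpos := lt_le_trans dz dx.
have Mx : ~ M x.
  move=> Mx; move: dpos; apply/negP; rewrite -leNgt.
  by rewrite -(enorm0 (R := R) (D := D)) -(subrr x) dist_to_le.
exists x; last by rewrite enormB.
split=> //; rewrite enorm_grad_dist //.
by rewrite ler_pM ?enorm_ge0 ?invr_ge0 ?dist_to_ge0 ?lef_pV2 ?posrE.
Qed.

(** Below the reach the projection is unique: two of them, [y] and [p], would give [|p - y|^2 / 2 <=
    K |p - y|^2 d_M(x) < |p - y|^2 / 2]. *)
Lemma enorm_grad_near K M x : M !=set0 -> compact M -> reach_bound K M ->
  ~ M x -> 2 * K * dist_to M x < 1 -> enorm (grad_dist M x) = 1.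
Proof.
move=> M0 cM KM Mx dK; rewrite enorm_grad_dist //.
have dpos := dist_to_gt0 M0 cM Mx.
have [y Py] := projections_nonempty M0 cM x; have [My xy] := Py.
suff -> : projections M x = [set y].
  by rewrite seb_center1 xy divff // gt_eqF.
apply/seteqP; split => [p [Mp xp]|_ ->] //=.
apply/subr0_eq/enorm0_eq0/eqP; apply: contraT => py.
have := KM x y p Py Mp; rewrite ler_norml => /andP[_].
have -> : dot (p - y) (x - y) = enorm (p - y) ^+ 2 / 2.
  have : enorm (x - p) ^+ 2 = enorm (x - y) ^+ 2 by rewrite xp xy.
  rewrite !enorm_sqr !dotE (dotC p x) (dotC y x) (dotC p y); lra.
have py2 : 0 < enorm (p - y) ^+ 2 by rewrite exprn_gt0 // lt_def py enorm_ge0.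
have := dK; rewrite -(ltr_pM2l py2); lra.
Qed.

(* Quadratic growth at [z'] turns the cross term [2 <q - x, z' - z>] into a
   bound linear in [|z - z'|]. *)
Lemma projections_near M A k c C e z z' x : M !=set0 -> compact M ->
    A `<=` M -> 0 < k -> 0 < c -> 0 < C -> 0 <= e ->
    dist_to A z ^+ 2 <= dist_to M z ^+ 2 + c * e ^+ 2 ->
    (forall y, M y -> exists2 p, projections M z' p &
      dist_to M z' ^+ 2 + k * enorm (y - p) ^+ 2 <= enorm (y - z') ^+ 2) ->
    enorm (z - z') <= C * e -> projections A z x ->
  exists2 q, projections M z' q &
    enorm (x - q) <= (1 + (2 * C + c) / k) * e.
Proof.
move=> M0 cM AM k0 c0 C0 e0 rb growth zz' [Ax zx].
have [q Pq qx] := growth x (AM _ Ax).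
exists q => //; have [Mq z'q] := Pq.
set s := enorm (x - q) in qx *.
have s0 : 0 <= s := enorm_ge0 _.
have ks : k * s ^+ 2 <= 2 * dot (q - x) (z' - z) + c * e ^+ 2.
  have : dist_to M z ^+ 2 <= enorm (z - q) ^+ 2.
    by rewrite ler_sqr ?nnegrE ?enorm_ge0 ?dist_to_ge0 // dist_to_le.
  move: rb qx; rewrite -zx -z'q !enorm_sqr !dotE.
  rewrite (dotC x z) (dotC q z) (dotC q z') (dotC x z'); lra.
have qz : dot (q - x) (z' - z) <= s * (C * e).
  apply: le_trans (dot_le _ _) _; rewrite (enormB q) (enormB z').
  by rewrite ler_wpM2l.
have Q0 : 0 < (2 * C + c) / k by rewrite divr_gt0 // addr_gt0 // mulr_gt0.
(* Assuming the contrary gives [e <= s], so [e ^+ 2 <= e * s] and a factor [s] cancels. *)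
rewrite leNgt; apply/negP => slt.
have es : e <= s.
  by apply: le_trans (ltW slt); rewrite ler_peMl // lerDl ltW.
have spos : 0 < s.
  by apply: le_lt_trans slt; rewrite mulr_ge0 // addr_ge0 // ltW.
have : k * s <= (2 * C + c) * e.
  rewrite -(ler_pM2r spos).
  have : c * e * e <= c * e * s by rewrite ler_wpM2l // mulr_ge0 // ltW.
  lra.
rewrite mulrC -ler_pdivlMr // mulrAC; lra.
Qed.

(** Near a projection this is (P3). Near any other point of [M], [enorm (y - z)] exceeds
    [dist_to M z] by a fixed gap, which absorbs the term in small [k]. Compactness of [M] merges the
    local ranges of [k]. *)
Lemma near_quadratic_growth M z : M !=set0 -> compact M -> condP3 M ->
    crit M z ->
  \forall k \near (0 : R)^'+, forall y, M y -> exists2 x, projections M z x &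
    dist_to M z ^+ 2 + k * enorm (y - x) ^+ 2 <= enorm (y - z) ^+ 2.
Proof.
move=> M0 cM P3 zcrit.
pose P (k : R) y := exists2 x, projections M z x &
    dist_to M z ^+ 2 + k * enorm (y - x) ^+ 2 <= enorm (y - z) ^+ 2.
have /near_covering_withinP cov : near_covering M.
  exact/compact_near_coveringP.
apply: (cov _ _ P) => c Mc.
have [Pc|nPc] := pselect (projections M z c).
  have [del [al [del0 al0 H]]] := P3 z c zcrit Pc.
  near=> y k => My; exists c => //.
  have yc : enorm (y - c) < del by near: y; exact: eball_near.
  have kal : k <= al by near: k; exact: nbhs_right_le.
  apply: le_trans (H y My yc); rewrite (enormB c) Pc.2 lerD2l.
  by rewrite ler_wpM2r ?sqr_ge0.
have [x Px] := projections_nonempty M0 cM z.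
have dc : dist_to M z < enorm (c - z).
  rewrite lt_neqAle enormB dist_to_le // andbT; apply/eqP => dE.
  by apply: nPc.
pose m := (dist_to M z + enorm (c - z)) / 2.
have d0 := dist_to_ge0 M0 cM z.
have m1 : dist_to M z < m by rewrite /m ltr_pdivlMr //; lra.
have m2 : m < enorm (c - z) by rewrite /m ltr_pdivrMr //; lra.
have g0 : 0 < m ^+ 2 - dist_to M z ^+ 2.
  by rewrite subr_gt0 ltr_sqr ?nnegrE // (le_trans d0 (ltW m1)).
pose B := 1 + enorm (c - x).
have B0 : 0 < B by rewrite ltr_pwDl ?enorm_ge0.
near=> y k => My; exists x => //.
have k0 : 0 < k by near: k; exact: nbhs_right_gt.
have kB : k * B ^+ 2 <= m ^+ 2 - dist_to M z ^+ 2.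
  rewrite -ler_pdivlMr ?exprn_gt0 //; near: k; apply: nbhs_right_le.
  by rewrite divr_gt0 // exprn_gt0.
have ym : m < enorm (y - z).
  near: y; have := @continuous_dist _ _ z c; move=> /cvgr_gt; exact.
have yc : enorm (y - c) < 1 by near: y; exact: eball_near.
have yB : enorm (y - x) ^+ 2 <= B ^+ 2.
  rewrite ler_sqr ?nnegrE ?enorm_ge0 ?ltW //.
  by rewrite (le_lt_trans (enorm_triangle y c x)) // ltrD2r.
have ym2 : m ^+ 2 <= enorm (y - z) ^+ 2.
  by rewrite ler_sqr ?nnegrE ?enorm_ge0 ?(le_trans d0) ?ltW.
rewrite -lerBrDl (le_trans (ler_wpM2l (ltW k0) yB)) // (le_trans kB) //.
by rewrite lerD2r.
Unshelve. all: by end_near. Qed.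

End Sampling.

(** * Choice of the constants and proof of the three claims *)

Theorem theorem1p6 (R : realType) (D d : nat) (M : set 'rV[R]_D)
    (hD : (2 <= D)%N) (hd : (1 <= d)%N) (M0 : M !=set0) (cM : compact M)
    (subM : C2_submanifold d M) :
  exists C1 C2 C3 C4 C5 eps0 : R,
    [/\ 0 < C1, 0 < C2 & 0 < C3] /\ [/\ 0 < C4, 0 < C5 & 0 < eps0] /\
    forall (A : set 'rV[R]_D) (eps : R),
      compact A -> A `<=` M ->
      (hausdorff A M <= eps%:E)%E -> eps <= eps0 ->
      forall z, crit A z ->
        let near_M : Prop := dist_to M z <= C1 * eps ^+ 2 in
        let near_Zmu : Prop :=
          (edist_to (mu_crit (C3 * eps) M) z <= (C2 * eps)%:E)%E in
        [/\ (near_M \/ near_Zmu) /\ ~ (near_M /\ near_Zmu),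
            condP4 M -> near_Zmu ->
              (edist_to (crit M) z <= (C4 * eps)%:E)%E
          & condP4 M -> condP1 M -> condP2 M -> condP3 M -> near_Zmu ->
              exists z', [/\ crit M z', enorm (z - z') <= C4 * eps
                & forall x, projections A z x ->
                    (edist_to (projections M z') x <= (C5 * eps)%:E)%E]].
Proof.
have [K K0 KM] := ex_reach_bound cM subM.
have [B MB] := compact_ebounded cM.
have B0 : 0 <= B by have [q Mq] := M0; exact: le_trans (enorm_ge0 _) (MB _ Mq).
(* Bounds the factor [1 + 2 * K * dist_to M z] of [dist_to_sample], since a critical point of [A]
   has [dist_to M z <= dist_to A z <= 2 * B]. *)
pose c := 1 + 2 * K * (2 * B).
have c1 : 1 <= c by rewrite /c lerDl !mulr_ge0 // ltW.
have c0 : 0 < c by exact: lt_le_trans c1.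
(* The constants are chosen before (P4) is assumed, hence a case distinction with default value 1;
   likewise for [k] below. *)
have [Cp [mu0 [Cp0 mu00 P4]]] : exists Cp mu0 : R, [/\ 0 < Cp, 0 < mu0 &
    condP4 M -> forall mu, 0 <= mu < mu0 -> forall z, mu_crit mu M z ->
      (edist_to (crit M) z <= (Cp * mu)%:E)%E].
  have [[C [mu0 [C0 /andP[mu00 _] H]]]|nP4] := pselect (condP4 M).
    by exists C, mu0.
  by exists 1, 1.
have [k [k0 kP]] : exists k : R, 0 < k /\ (condP2 M -> condP3 M ->
    forall z, crit M z -> forall y, M y -> exists2 x, projections M z x &
      dist_to M z ^+ 2 + k * enorm (y - x) ^+ 2 <= enorm (y - z) ^+ 2).
  have [[P2 P3]|nP] := pselect (condP2 M /\ condP3 M); last first.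
    by exists 1; split => // P2 P3; exfalso; exact: nP.
  have H := near_finite_set _ P2
    (fun z zc => @near_quadratic_growth _ _ M z M0 cM P3 zc).
  have [k [k0 kP]] := filter_ex (filterI (nbhs_right_gt (0 : R)) (H _)).
  by exists k.
(* [C1] is [crit_near] at [b = c * eps ^+ 2]; [C3] is [crit_far] for [dist_to M z > 1 / (4 * K)];
   [C4] adds the (P4) bound at [mu = C3 * eps] to [c * eps]; [C5] is [projections_near] at
   [C = C4]. *)
pose C1 := 2 * K * c; pose C3 := 8 * K * c.
pose C4 := c + Cp * C3; pose C5 := 1 + (2 * C4 + c) / k.
have C10 : 0 < C1 by rewrite /C1 !mulr_gt0.
have C30 : 0 < C3 by rewrite /C3 !mulr_gt0.
have C40 : 0 < C4 by rewrite /C4 addr_gt0 // mulr_gt0.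
have C50 : 0 < C5.
  by rewrite /C5 addr_gt0 // divr_gt0 // addr_gt0 // mulr_gt0.
have [e0 [e00 e01 eC3 eC1 emu]] : exists e0, [/\ 0 < e0, e0 <= 1,
    C3 * e0 <= 1 / 2, 4 * K * ((C1 + c) * e0) <= 1 & C3 * e0 <= mu0 / 2].
  exists (Num.min (Num.min 1 (1 / 2 / C3))
    (Num.min (1 / (4 * K * (C1 + c))) (mu0 / 2 / C3))).
  have Q0 : 0 < 4 * K * (C1 + c) by rewrite !mulr_gt0 // addr_gt0.
  rewrite !lt_min !ltr01 !divr_gt0 //.
  split=> //; first by rewrite !ge_min lexx.
  - by rewrite mulrC -ler_pdivlMr // !ge_min lexx ?orbT.
  - by rewrite mulrA mulrC -ler_pdivlMr // !ge_min lexx ?orbT.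
  - by rewrite mulrC -ler_pdivlMr // !ge_min lexx ?orbT.
exists C1, c, C3, C4, C5, e0; split=> //; split=> //.
move=> A e cA AM haus ee0 z zcrit near_M near_Zmu.
have dense0 := hausdorff_le haus.
have A0 : A !=set0.
  have [y My] := M0.
  by have [a Aa _] := edist_to_approx (dense0 y My) ltr01; exists a.
have dense y : M y -> exists2 a, A a & enorm (y - a) <= e.
  move=> My; have [a Aa ya] := edist_to_attained y A0 cA.
  by exists a => //; rewrite -lee_fin -ya dense0.
have e_ge0 : 0 <= e.
  by have [y /dense[a _]] := M0; exact: le_trans (enorm_ge0 _).
have e1 : e <= 1 by exact: le_trans e01.
have dA_le : dist_to A z <= 2 * B.
  by apply: crit_dist_to_le => // x /AM; exact: MB.
have dMA : dist_to M z <= dist_to A z.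
  have [p [Ap <-]] := projections_nonempty A0 cA z.
  exact/dist_to_le/AM.
have dM0 := dist_to_ge0 M0 cM z.
have sample : dist_to A z ^+ 2 <= dist_to M z ^+ 2 + c * e ^+ 2.
  apply: le_trans (dist_to_sample z M0 cM A0 cA AM KM (ltW K0) dense) _.
  rewrite lerD2l ler_wpM2r ?sqr_ge0 // /c lerD2l.
  apply: ler_wpM2l; first by rewrite mulr_ge0 // ltW.
  exact: le_trans dMA dA_le.
have e2e : e ^+ 2 <= e by rewrite expr2 ler_piMr.
(* Both cases together would put a mu-critical point within the reach of [M], where the gradient has
   norm 1, whereas [mu <= 1 / 2]. *)
have excl : ~ (near_M /\ near_Zmu).
  move=> [nM nZ]; have K8 : 0 < 1 / (8 * K) by rewrite divr_gt0 // mulr_gt0.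
  have [x [Mx gx] zx] := edist_to_approx nZ K8.
  have xd : dist_to M x <= (C1 + c) * e0 + 1 / (8 * K).
    apply: le_trans (dist_to_lipschitz M0 cM x z) _; rewrite enormB.
    have : C1 * e ^+ 2 <= C1 * e0 by rewrite ler_pM2l // (le_trans e2e).
    have : c * e <= c * e0 by rewrite ler_pM2l.
    by move: nM zx; rewrite /near_M; lra.
  have Kd : 2 * K * dist_to M x < 1.
    have : 2 * K * dist_to M x <= 2 * K * ((C1 + c) * e0 + 1 / (8 * K)).
      by rewrite ler_pM2l // mulr_gt0.
    have -> : 2 * K * ((C1 + c) * e0 + 1 / (8 * K)) =
        2^-1 * (4 * K * ((C1 + c) * e0)) + 1 / 4 by field; rewrite gt_eqF.
    by move: eC1; lra.
  have : C3 * e <= C3 * e0 by rewrite ler_pM2l.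
  by move: gx; rewrite (enorm_grad_near M0 cM KM Mx Kd); lra.
have dich : near_M \/ near_Zmu.
  have [dK|dK] := leP (4 * K * dist_to M z) 1.
    left; rewrite /near_M /C1 -(mulrA (2 * K)).
    apply: (crit_near M0 cM A0 cA AM KM) => //.
    by rewrite mulr_ge0 ?sqr_ge0 //; exact: ltW.
  right; rewrite /near_Zmu.
  have dpos : 0 < dist_to M z.
    rewrite lt_def dM0 andbT; apply/eqP => dz.
    by move: dK; rewrite dz mulr0 ltr10.
  have [x [Mx gx] zx] := crit_far M0 cM A0 cA AM zcrit c1 e_ge0 dpos sample.
  apply: (@le_trans _ _ (enorm (z - x))%:E); last by rewrite lee_fin.
  apply: edist_to_le; split=> //; apply: le_trans gx _.
  rewrite ler_pdivrMr //.
  have ce : 0 <= 2 * (c * e) by rewrite mulr_ge0 // mulr_ge0 // ltW.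
  by have := ler_wpM2l ce (ltW dK); rewrite /C3; lra.
have part2 : condP4 M -> near_Zmu -> (edist_to (crit M) z <= (C4 * e)%:E)%E.
  (* The two infima need not be attained: each approximation costs [h / 2], with [h] arbitrary. *)
  move=> p4 nZ; apply/lee_addgt0Pr => h h0.
  have h20 : 0 < h / 2 by rewrite divr_gt0.
  have [w wcrit zw] := edist_to_approx nZ h20.
  have mu_lt : 0 <= C3 * e < mu0.
    rewrite mulr_ge0 ?(ltW C30) //=.
    have : C3 * e <= C3 * e0 by rewrite ler_pM2l.
    lra.
  have [q qcrit wq] := edist_to_approx (P4 p4 _ mu_lt _ wcrit) h20.
  apply: le_trans (edist_to_le z qcrit) _; rewrite -EFinD lee_fin.
  by apply: le_trans (enorm_triangle z w q) _; rewrite /C4; lra.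
split=> // p4 _ p2 p3 nearZ.
have zZ := part2 p4 nearZ.
have Z0 : crit M !=set0.
  by have [q Zq _] := edist_to_approx zZ ltr01; exists q.
(* A finite [crit M] is compact, so a nearest critical point exists and [C4 * e] needs no slack. *)
have [z' Zz' zz'] := edist_to_attained z Z0 (finite_compact p2).
have zz'e : enorm (z - z') <= C4 * e by rewrite -lee_fin -zz'.
exists z'; split=> // x Px.
have [q Pq xq] := projections_near M0 cM AM k0 c0 C40 e_ge0 sample
  (kP p2 p3 z' Zz') zz'e Px.
by apply: le_trans (edist_to_le x Pq) _; rewrite lee_fin.
Qed.
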